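(* Let $f$ be a rational function (with complex coefficients) all of whose critical points are real. Then $f$ is equivalent to a real rational function; that is, there exists a fractional-linear transformation $\ell$ such that $\ell\circ f$ is a rational function with real coefficients.
   Context: Rational functions are regarded as holomorphic maps $\mathbb{CP}^1\to\mathbb{CP}^1$ of the Riemann sphere, and critical points are points of $\mathbb{CP}^1$; a point is real if it lies on the circle $\mathbb{R}\cup\{\infty\}$. Two rational functions $f_1,f_2$ are called equivalent if $f_1=\ell\circ f_2$ for some fractional-linear transformation $\ell$ (with complex coefficients). *)

(* Defs.v *)
From HB Require Import structures.
From mathcomp Require Import all_boot all_order all_algebra.
From mathcomp Require Import complex.
From mathcomp Require Import all_classical all_reals all_analysis.

Set Implicit Arguments.
Unset Strict Implicit.
Unset Printing Implicit Defensive.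

Import Order.TTheory GRing.Theory Num.Theory numFieldNormedType.Exports.

Local Open Scope ring_scope.
Local Open Scope complex_scope.

(* [R[i]^o] is R[i] seen as a normed space over itself; in particular the
   derivatives below are complex derivatives. *)
Definition CP1 (R : realType) : Type := one_point_compactification R[i]^o.

Definition real_point (R : realType) (x : CP1 R) : Prop :=
  if x is Some z then complex.Im z = 0 else True.

(* The holomorphic map CP1 -> CP1 defined by p / q in lowest terms. At infinity,
   if deg p <= deg q, the value is the ratio of the coefficients of p and q in
   degree deg q. *)
Definition rational_map (R : realType) (p q : {poly R[i]}) (x : CP1 R) : CP1 R :=
  match x with
  | Some z => if q.[z] == 0 then None else Some (p.[z] / q.[z])
  | None => if (size q < size p)%N then None
            else Some (p`_(size q).-1 / lead_coef q)
  end.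

Definition rational_function (R : realType) (f : CP1 R -> CP1 R) : Prop :=
  exists p q : {poly R[i]},
    [/\ q != 0, coprimep p q & f =1 rational_map p q].

Definition real_rational_function (R : realType) (f : CP1 R -> CP1 R) : Prop :=
  exists p q : {poly R},
    [/\ q != 0, coprimep p q
      & f =1 rational_map (map_poly (real_complex R) p)
                          (map_poly (real_complex R) q)].

Definition fractional_linear (R : realType) (l : CP1 R -> CP1 R) : Prop :=
  exists a b c d : R[i], a * d - b * c != 0 /\
    forall x : CP1 R, l x =
      match x with
      | Some z => if c * z + d == 0 then None
                  else Some ((a * z + b) / (c * z + d))
      | None => if c == 0 then None else Some (a / c)
      end.

(* The involution x |-> 1/x of CP1. *)
Definition CP1_inv (R : realType) (x : CP1 R) : CP1 R :=
  match x with
  | Some z => if z == 0 then None else Some z^-1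
  | None => Some 0
  end.

(* The chart z of CP1 minus infinity; the value at infinity is irrelevant. *)
Definition affine_coord (R : realType) (x : CP1 R) : R[i]^o :=
  if x is Some z then z else 0.

(* The standard holomorphic coordinate around x (z if x is finite, 1/z if x is
   infinity), and its inverse parametrization. *)
Definition chart (R : realType) (x : CP1 R) : CP1 R -> R[i]^o :=
  if x is Some _ then @affine_coord R else @affine_coord R \o @CP1_inv R.

Definition chart_inv (R : realType) (x : CP1 R) : R[i]^o -> CP1 R :=
  if x is Some _ then Some else @CP1_inv R \o Some.

(* The derivative of f at x, read in local coordinates at x and at f x,
   vanishes. *)
Definition critical_point (R : realType) (f : CP1 R -> CP1 R) (x : CP1 R) :
    Prop :=
  is_derive (chart x x) 1 (chart (f x) \o f \o chart_inv x) 0.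

(* Main.v *)
Require Import Defs.
From mathcomp Require Import all_boot all_order all_algebra.
From mathcomp Require Import all_classical all_reals all_analysis.
From HB Require Import structures.
From mathcomp Require Import complex separable ring zify.

Set Implicit Arguments.
Unset Strict Implicit.
Unset Printing Implicit Defensive.

Import Order.TTheory GRing.Theory Num.Theory numFieldNormedType.Exports.
Local Open Scope ring_scope.

(** Write f = p / q in lowest terms. The finite critical points of f are the
    roots of the wronskian W = p' q - p q', and replacing f by an equivalent
    function amounts to choosing another basis of the pencil spanned by p and
    q. So the claim is that a pencil whose wronskian has only real roots has a
    basis of real polynomials.

    The proof goes through the Gaudin model and its Bethe ansatz. A real change
    of variable x = x0 + 1/y, with x0 a generic real number ([real_pencil]),
    reduces to a basis P, Q such that Q is monic with deg Q < deg P and has no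
    root in common with W = P' Q - P Q'. Hence the roots t_1, ..., t_m of Q are
    simple, and n = deg W >= 2 m. Let z_1, ..., z_n be the roots of W, repeated
    according to multiplicity. Both P and Q solve the differential equation
      W u'' - W' u' + V u = 0,  where V = P'' Q' - P' Q''
    ([wronskian_ode]). At u = Q and x = t_j it becomes the Bethe equation
      sum_i 1 / (t_j - z_i) = sum_(l <> j) 2 / (t_j - t_l).

    Consider functions on the subsets of {1, ..., n}, that is, the vectors of
    the n-fold tensor power of C^2. For x outside the z_i, the Gaudin operator
      T(x) = sum_(i < k) (P_ik - 1) / ((x - z_i) (x - z_k)),
    where P_ik exchanges the factors i and k, is symmetric, with real
    coefficients if x and the z_i are real. Hence the eigenvalues of T(x) are real
    when the critical points are ([gaudin_eigenvalue_real]). The Bethe vector,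
    which is obtained from the vacuum by applying the raising operators
    sum_i f_i / (t_j - z_i) for all j, is an eigenvector of T(x) as soon as the
    Bethe equations hold ([gaudin_bethe_offshell]). Its eigenvalue is
    (Q'' - (W' / W) Q') / Q = - V / W. Moreover the Bethe vector is not zero: a
    raising operator all of whose coefficients are nonzero is injective below the
    middle level of the lattice of subsets, and 2 m <= n + 1 ([raising_inj],
    [bethe_neq0]). The z_i may coincide in all of this, so multiple critical
    points are covered.

    Therefore V is a real polynomial, and the complex conjugate of Q solves the
    same equation as Q. Their wronskian is proportional to W but of smaller
    degree, so it vanishes and Q is real; then P is real up to a multiple of Q
    ([real_pencil_monic]). *)

(** * Spin operators and the Gaudin operator *)

Section Gaudin.
Variables (C : fieldType) (I : finType).
Local Notation vect := {ffun {set I} -> C^o}.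
Implicit Types (a b c : I -> C) (g h : vect) (J : {set I}).

(** Functions on the subsets of I stand for the vectors of the tensor product of
    copies of C^2 indexed by I: the basis vector of J has the spin i flipped
    exactly if i is in J. With f_i, e_i and h_i the usual generators of sl_2 acting
    on the factor i, [raising a] is the sum of the a_i f_i, [lowering b] that of
    the b_i e_i, and [weight b] that of the b_i (1 - h_i) / 2. *)
Definition raising a g : vect := [ffun J : {set I} => \sum_(i in J) a i * g (J :\ i)].
Definition lowering b g : vect :=
  [ffun J : {set I} => \sum_(k | k \notin J) b k * g (k |: J)].
Definition weight b g : vect := [ffun J : {set I} => (\sum_(i in J) b i) * g J].

Lemma vectD g h J : (g + h) J = g J + h J. Proof. by rewrite ffunE. Qed.
Lemma vectN g J : (- g) J = - g J. Proof. by rewrite ffunE. Qed.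
Lemma vectZ (x : C) g J : (x *: g) J = x * g J. Proof. by rewrite ffunE. Qed.
Definition vectE := (vectD, vectN, vectZ).

Lemma raisingE a g J : raising a g J = \sum_(i in J) a i * g (J :\ i).
Proof. by rewrite ffunE. Qed.
Lemma loweringE b g J : lowering b g J = \sum_(k | k \notin J) b k * g (k |: J).
Proof. by rewrite ffunE. Qed.
Lemma weightE b g J : weight b g J = (\sum_(i in J) b i) * g J.
Proof. by rewrite ffunE. Qed.

Lemma raising_is_linear a : linear (raising a).
Proof.
move=> x g h; apply/ffunP => J; rewrite vectD vectZ !raisingE mulr_sumr -big_split /=.
by apply: eq_bigr => i _; rewrite vectD vectZ mulrDr mulrCA.
Qed.
HB.instance Definition _ a :=
  GRing.isLinear.Build C vect vect _ (raising a) (raising_is_linear a).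


Lemma eq_raising a b g : a =1 b -> raising a g = raising b g.
Proof.
by move=> eqab; apply/ffunP => J; rewrite !raisingE; apply: eq_bigr => i _; rewrite eqab.
Qed.

(** The coefficients have the shape that partial fractions produce, as in
    [weight_lin]. *)
Lemma raising_lin (x : C) a b g :
  raising (fun i => (a i - b i) / x) g = x^-1 *: (raising a g - raising b g).
Proof.
apply/ffunP => J; rewrite !vectE !raisingE -sumrB mulr_sumr.
by apply: eq_bigr => i _; rewrite -mulrBl mulrA (mulrC x^-1).
Qed.

Lemma raisingC a b g : raising a (raising b g) = raising b (raising a g).
Proof.
apply/ffunP => J; rewrite !raisingE.
under eq_bigr do rewrite raisingE mulr_sumr.
under [RHS]eq_bigr do rewrite raisingE mulr_sumr.
rewrite (exchange_big_dep (mem J)) /=; last by move=> i j _; rewrite !inE => /andP[].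
apply: eq_bigr => j jJ; apply: eq_big => [i|i _].
  by rewrite !inE jJ andbT andbC eq_sym.
by rewrite mulrCA !finset.setDDl [[set _] :|: _]finset.setUC.
Qed.

(** This is the relation [e_i, f_j] = delta_ij h_i: in both orders the terms that
    replace an element of J by one outside agree, and the diagonal terms come from the i
    outside J on one side and from the i in J on the other. *)
Lemma lowering_raising a b g : lowering b (raising a g) =
  raising a (lowering b g) + (\sum_i b i * a i) *: g
    - 2 *: weight (fun i => b i * a i) g.
Proof.
apply/ffunP => J; rewrite !vectE weightE raisingE loweringE.
have -> : \sum_(k | k \notin J) b k * raising a g (k |: J) =
    (\sum_(k | k \notin J) b k * a k) * g J
    + \sum_(i in J) \sum_(k | k \notin J) b k * (a i * g (k |: (J :\ i))).
  rewrite exchange_big mulr_suml -big_split /=; apply: eq_bigr => k kJ.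
  rewrite raisingE (finset.big_setU1 k kJ) /= finset.setU1K // mulrDr mulrA; congr (_ + _).
  rewrite mulr_sumr; apply: eq_bigr => i iJ; congr (_ * (_ * g _)).
  apply/setP => l; rewrite !inE; case: (eqVneq l k) => [->|] //=.
  by rewrite andbT; apply/eqP => ki; rewrite ki iJ in kJ.
have -> : \sum_(i in J) a i * lowering b g (J :\ i) =
    (\sum_(i in J) b i * a i) * g J
    + \sum_(i in J) \sum_(k | k \notin J) b k * (a i * g (k |: (J :\ i))).
  rewrite mulr_suml -big_split /=; apply: eq_bigr => i iJ.
  rewrite loweringE (bigD1 i) /=; last by rewrite !inE eqxx.
  rewrite finset.setD1K // mulrDr mulrA (mulrC (a i)) mulr_sumr; congr (_ + _).
  apply: eq_big => [k|k _]; last by rewrite mulrCA.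
  by rewrite !inE negb_and negbK; case: (eqVneq k i) => [->|] //=; rewrite ?iJ ?andbT.
rewrite [in \sum_i b i * a i](bigID (mem J)) /=; ring.
Qed.

Lemma weight_lin (x : C) a b g :
  weight (fun i => (a i - b i) / x) g = x^-1 *: (weight a g - weight b g).
Proof.
apply/ffunP => J; rewrite !vectE !weightE -mulr_suml sumrB; ring.
Qed.

Lemma eq_weight a b g : a =1 b -> weight a g = weight b g.
Proof.
by move=> eqab; apply/ffunP => J; rewrite !weightE; under eq_bigr do rewrite eqab.
Qed.

(** Adding i to a set adds b_i to its weight. *)
Lemma weight_raising a b g :
  weight b (raising a g) = raising a (weight b g) + raising (fun i => b i * a i) g.
Proof.
apply/ffunP => J; rewrite vectD weightE !raisingE mulr_sumr -big_split /=.
apply: eq_bigr => i iJ; rewrite weightE (finset.big_setD1 i iJ) /=; ring.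
Qed.

(** This is the sum over the pairs i < k of w_i w_k (P_ik - 1), where P_ik
    exchanges the factors i and k. Indeed, the product of [raising w] and
    [lowering w] moves one element out of J and another one in, up to a diagonal
    term. The present form makes both the symmetry of the operator and its
    commutation with the raising operators easy to see. *)
Definition gaudin w g : vect :=
  raising w (lowering w g) - weight (fun i => w i ^+ 2) g
  - (\sum_i w i) *: weight w g + weight w (weight w g).

Lemma weightD b g h : weight b (g + h) = weight b g + weight b h.
Proof. by apply/ffunP => J; rewrite !(vectE, weightE) mulrDr. Qed.

(** Only first-order terms in [lowering] survive here: the commutator of the
    Gaudin operator with a raising operator is built from raising operators and
    weights. *)
Lemma gaudin_raising w a g : gaudin w (raising a g) =
  raising a (gaudin w g)
  + ((\sum_i w i * a i) *: raising w g - 2 *: raising w (weight (fun i => w i * a i) g)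
     - (\sum_i w i) *: raising (fun i => w i * a i) g
     + 2 *: raising (fun i => w i * a i) (weight w g)).
Proof.
rewrite /gaudin lowering_raising !weight_raising !linearD !linearN !linearZ /= weightD.
rewrite !weight_raising !(raisingC w a).
rewrite (@eq_raising (fun i => w i ^+ 2 * a i) (fun i => w i * (w i * a i))); last first.
  by move=> i; rewrite expr2 mulrA.
apply/ffunP => J; rewrite !vectE; ring.
Qed.

(** * The Bethe vector *)

Variable z : I -> C.
Implicit Types (t r x : C) (s : seq C).

Definition pole x : I -> C := fun i => (x - z i)^-1.
Definition vacuum : vect := [ffun J : {set I} => (J == finset.set0)%:R].
Definition bethe (s : seq C) : vect := foldr (fun t => raising (pole t)) vacuum s.
Definition logder (s : seq C) x : C := \sum_(r <- s) (x - r)^-1.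

Lemma weight_vacuum b : weight b vacuum = 0.
Proof.
apply/ffunP => J; rewrite weightE !ffunE.
by case: eqP => [->|_]; rewrite ?finset.big_set0 ?mul0r ?mulr0.
Qed.

Lemma gaudin_vacuum w : gaudin w vacuum = 0.
Proof.
have low0 : lowering w vacuum = 0.
  apply/ffunP => J; rewrite loweringE ffunE big1 // => k _; rewrite ffunE.
  by case: eqP => [/setP/(_ k)|_]; rewrite ?mulr0 // !inE eqxx.
have weight0 : weight w 0 = 0 by apply/ffunP => J; rewrite weightE !ffunE mulr0.
by rewrite /gaudin low0 !weight_vacuum weight0 linear0 scaler0 !subr0 addr0.
Qed.

(** Since raising operators commute, any of them can be applied last. *)
Lemma bethe_rem r s : r \in s -> raising (pole r) (bethe (rem r s)) = bethe s.
Proof.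
elim: s => //= t s IH; rewrite inE; case: (eqVneq t r) => [-> //|tr].
by move=> /= rs; rewrite raisingC IH.
Qed.

Lemma rem_cons_in t r s : t \notin s -> r \in s -> rem r (t :: s) = t :: rem r s.
Proof. by move=> ts rs /=; case: eqP => // tr; rewrite tr rs in ts. Qed.

Lemma rem_cons_head t s : rem t (t :: s) = s.
Proof. by rewrite /= eqxx. Qed.

Lemma bethe_cons t s : bethe (t :: s) = raising (pole t) (bethe s).
Proof. by []. Qed.

(** The weight acts as a derivation on products of raising operators, and it
    kills the vacuum. *)
Lemma weight_bethe b s : uniq s ->
  weight b (bethe s) = \sum_(r <- s) raising (fun i => b i * pole r i) (bethe (rem r s)).
Proof.
elim: s => [|t s IH]; first by rewrite big_nil weight_vacuum.
rewrite cons_uniq bethe_cons big_cons rem_cons_head => /andP[ts us].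
rewrite weight_raising IH // addrC; congr (_ + _).
rewrite linear_sum; apply: eq_big_seq => r rs.
by rewrite (rem_cons_in ts rs) bethe_cons; exact: raisingC.
Qed.

(** All the simplifications of the Bethe ansatz come from this partial fraction
    expansion. *)
Lemma pole_mul t r i : t != r -> t != z i -> r != z i ->
  pole t i * pole r i = (pole r i - pole t i) / (t - r).
Proof.
rewrite /pole -subr_eq0 -[t == z i]subr_eq0 -[r == z i]subr_eq0 => h1 h2 h3.
by field; apply/and3P.
Qed.

Lemma raising_pole_mul t r g : t != r -> (forall i, t != z i) -> (forall i, r != z i) ->
  raising (fun i => pole t i * pole r i) g
    = (t - r)^-1 *: (raising (pole r) g - raising (pole t) g).
Proof.
by move=> tr tz rz; rewrite -raising_lin; apply: eq_raising => i; exact: pole_mul.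
Qed.

Lemma weight_pole_bethe t s : uniq s -> t \notin s -> (forall i, t != z i) ->
    (forall r, r \in s -> forall i, r != z i) ->
  weight (pole t) (bethe s)
    = logder s t *: bethe s
      - \sum_(r <- s) (t - r)^-1 *: raising (pole t) (bethe (rem r s)).
Proof.
move=> us ts tz sz; rewrite weight_bethe // /logder scaler_suml -sumrB.
apply: eq_big_seq => r rs; rewrite raising_pole_mul //; last exact: sz.
  by rewrite bethe_rem // scalerBr.
by apply: contraNneq ts => ->.
Qed.

Definition rootpoly (s : seq C) : {poly C} := \prod_(r <- s) ('X - r%:P).

Lemma rootpoly_cons t s : rootpoly (t :: s) = ('X - t%:P) * rootpoly s.
Proof. exact: big_cons. Qed.

Lemma rootpoly_neq0 s x : x \notin s -> (rootpoly s).[x] != 0.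
Proof. by rewrite /rootpoly => xs; rewrite -[_ == 0]/(root _ x) root_prod_XsubC. Qed.

Lemma deriv_rootpoly s x : x \notin s ->
  (rootpoly s)^`().[x] = (rootpoly s).[x] * logder s x.
Proof.
elim: s => [|t s IH]; first by rewrite /rootpoly /logder !big_nil derivC hornerC mulr0.
rewrite inE negb_or => /andP[xt xs]; rewrite rootpoly_cons /logder big_cons -/(logder s x).
rewrite derivM derivXsubC mul1r !(hornerXsubC, hornerM, hornerD) IH //.
by rewrite -subr_eq0 in xt; field.
Qed.

(** With W the product of the X - z_i and q = [rootpoly s], this is
    (q'' - (W' / W) q') / q at x. *)
Definition energy (s : seq C) x : C :=
  ((rootpoly s)^`()^`().[x] - (\sum_i pole x i) * (rootpoly s)^`().[x]) / (rootpoly s).[x].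

Lemma energy_cons t s x : x != t -> x \notin s ->
  energy (t :: s) x = energy s x + (2 * logder s x - \sum_i pole x i) / (x - t).
Proof.
move=> xt xs; have q0 := rootpoly_neq0 xs.
have -> : logder s x = (rootpoly s)^`().[x] / (rootpoly s).[x].
  by rewrite deriv_rootpoly // mulrAC mulfV // mul1r.
rewrite /energy rootpoly_cons derivM derivXsubC mul1r derivD derivM derivXsubC mul1r.
rewrite !(hornerXsubC, hornerM, hornerD).
by rewrite -subr_eq0 in xt; field; rewrite q0 xt.
Qed.

(** The expansion holds for arbitrary t_j; the unwanted terms, in which some
    [pole t_j] is replaced by [pole x], vanish exactly if the Bethe equations
    hold. By induction on s: commuting the Gaudin operator with the raising
    operator of t produces weights, which act on the remaining factors by
    [weight_pole_bethe]. *)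
Lemma gaudin_bethe_offshell s x : uniq s -> x \notin s -> (forall i, x != z i) ->
    (forall r, r \in s -> forall i, r != z i) ->
  gaudin (pole x) (bethe s) = energy s x *: bethe s
    + \sum_(r <- s) ((\sum_i pole r i - 2 * logder (rem r s) r) / (x - r))
        *: raising (pole x) (bethe (rem r s)).
Proof.
elim: s => [|t s IH] us xs xz sz.
  rewrite big_nil addr0 gaudin_vacuum /energy /rootpoly big_nil !(derivC, hornerC).
  by rewrite mulr0 subr0 mul0r scale0r.
move: us xs; rewrite cons_uniq inE negb_or => /andP[ts us] /andP[xt xs].
have tz : forall i, t != z i by apply: sz; rewrite inE eqxx.
have {}sz : forall r, r \in s -> forall i, r != z i.
  by move=> r rs; apply: sz; rewrite inE rs orbT.
have xt0 : x - t != 0 by rewrite subr_eq0.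
rewrite big_cons rem_cons_head.
(* The terms in which the factor of some r in s has been replaced by the raising
   operator of x, with the three kinds of coefficients that occur. *)
pose A := \sum_(r <- s) ((\sum_i pole r i - 2 * logder (rem r s) r) / (x - r))
  *: raising (pole x) (raising (pole t) (bethe (rem r s))).
pose B1 := \sum_(r <- s)
  (t - r)^-1 *: raising (pole x) (raising (pole t) (bethe (rem r s))).
pose B3 := \sum_(r <- s)
  (x - r)^-1 *: raising (pole x) (raising (pole t) (bethe (rem r s))).
(* Adding t to s changes the coefficient of r by - 2 / ((r - t) (x - r)), which is
   2 / (x - t) times 1 / (t - r) - 1 / (x - r). *)
have -> : \sum_(r <- s) ((\sum_i pole r i - 2 * logder (rem r (t :: s)) r) / (x - r))
    *: raising (pole x) (bethe (rem r (t :: s)))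
    = A + (2 / (x - t)) *: (B1 - B3).
  rewrite scalerBr !scaler_sumr -sumrB -big_split; apply: eq_big_seq => r rs.
  rewrite (rem_cons_in ts rs) bethe_cons /= !scalerA -scalerBl -scalerDl; congr (_ *: _).
  rewrite /logder big_cons -/(logder _ _).
  have tr0 : t - r != 0 by rewrite subr_eq0; apply: contraNneq ts => ->.
  have xr0 : x - r != 0 by rewrite subr_eq0; apply: contraNneq xs => ->.
  by rewrite -[r - t]opprB invrN; field; rewrite xt0 tr0 ?xr0.
rewrite bethe_cons gaudin_raising IH // linearD linearZ linear_sum /=.
rewrite energy_cons //.
set v := bethe s; set F := raising (pole x); set G := raising (pole t).
have -> : raising (fun i => pole x i * pole t i) v = (x - t)^-1 *: (G v - F v).
  exact: raising_pole_mul.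
have -> : \sum_i pole x i * pole t i = (x - t)^-1 * (\sum_i pole t i - \sum_i pole x i).
  by rewrite -sumrB mulr_sumr; apply: eq_bigr => i _; rewrite pole_mul // mulrC.
have -> : weight (fun i => pole x i * pole t i) v
    = (x - t)^-1 *: (weight (pole t) v - weight (pole x) v).
  by rewrite -weight_lin; apply: eq_weight => i; exact: pole_mul.
rewrite raising_pole_mul // !weight_pole_bethe //.
(* This sum, with two raising operators of x, cancels in the end. *)
pose B2 := \sum_(r <- s) (x - r)^-1 *: F (F (bethe (rem r s))).
have FZ k u : F (k *: u) = k *: F u by exact: linearZ.
have GZ k u : G (k *: u) = k *: G u by exact: linearZ.
have FB u u' : F (u - u') = F u - F u' by exact: linearB.
have GB u u' : G (u - u') = G u - G u' by exact: linearB.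
have FG u : G (F u) = F (G u) by exact: raisingC.
have FS k (f : C -> vect) : F (\sum_(r <- s) k r *: f r) = \sum_(r <- s) k r *: F (f r).
  by rewrite /F linear_sum; apply: eq_bigr => r _; exact: linearZ.
have GS k (f : C -> vect) : G (\sum_(r <- s) k r *: f r) = \sum_(r <- s) k r *: G (f r).
  by rewrite /G linear_sum; apply: eq_bigr => r _; exact: linearZ.
have GA : \sum_(r <- s) G (((\sum_i pole r i - 2 * logder (rem r s) r) / (x - r))
    *: F (bethe (rem r s))) = A.
  by apply: eq_bigr => r _; rewrite GZ FG.
have GF : \sum_(r <- s) (x - r)^-1 *: G (F (bethe (rem r s))) = B3.
  by apply: eq_bigr => r _; rewrite FG.
rewrite -/F -/G !(FZ, FB, GZ, GB, FS, GS) GA GF -/v -/B1 -/B2.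
move: (F v) (G v) A B1 B2 B3 {GA GF} => Fv Gv A B1 B2 B3.
apply/ffunP => J; rewrite !vectE.
move: (A J) (B1 J) (B2 J) (B3 J) (Fv J) (Gv J) ((x - t)^-1) => a b1 b2 b3 fv gv y.
ring.
Qed.

End Gaudin.

(** * Real eigenvalues and nonvanishing of the Bethe vector *)

Section Positivity.
Variables (C : numClosedFieldType) (I : finType).
Local Notation vect := {ffun {set I} -> C^o}.
Implicit Types (a b w : I -> C) (g h : vect) (J : {set I}).

Definition conjv g : vect := [ffun J : {set I} => (g J)^*].

Lemma conjvE g J : conjv g J = (g J)^*. Proof. by rewrite ffunE. Qed.

(** Both sides run over the pairs of a set and one of its elements. *)
Lemma raising_adjoint a g h :
  \sum_J raising a g J * h J = \sum_J g J * lowering a h J.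
Proof.
under eq_bigr do rewrite raisingE mulr_suml.
under [RHS]eq_bigr do rewrite loweringE mulr_sumr.
rewrite (exchange_big_dep predT) //= [RHS](exchange_big_dep predT) //=.
apply: eq_bigr => i _.
rewrite (reindex_onto (fun J => i |: J) (fun J => J :\ i)) /=; last first.
  by move=> J iJ; rewrite finset.setD1K.
apply: eq_big => [J|J /andP[_ /eqP->]]; last by rewrite mulrCA mulrA.
rewrite finset.setU11 /=; apply/eqP/idP => [<-|iJ]; first by rewrite !inE eqxx.
by rewrite finset.setU1K.
Qed.

Lemma lowering_conj a g J : (forall i, a i \is Num.real) ->
  lowering a (conjv g) J = (lowering a g J)^*.
Proof.
move=> ar; rewrite !loweringE rmorph_sum; apply: eq_bigr => i _ /=.
by rewrite rmorphM /= (CrealP (ar i)) conjvE.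
Qed.

Lemma raising_conj a g : (forall i, a i \is Num.real) ->
  raising a (conjv g) = conjv (raising a g).
Proof.
move=> ar; apply/ffunP => J; rewrite conjvE !raisingE rmorph_sum.
apply: eq_bigr => i _ /=.
by rewrite rmorphM /= (CrealP (ar i)) conjvE.
Qed.

Lemma norm_eq0 g : \sum_J `|g J| ^+ 2 = 0 -> g = 0.
Proof.
move=> /eqP; rewrite psumr_eq0 => [|J _]; last exact: exprn_ge0.
move=> /allP g0; apply/ffunP => J; rewrite [RHS]ffunE; apply/eqP.
by have := g0 J (mem_index_enum J); rewrite /= expf_eq0 normr_eq0.
Qed.

(** The hermitian form of the operator takes real values: its nondiagonal part
    gives the square norm of [lowering w g], since [raising w] is the adjoint of
    [lowering w], and its diagonal part is real. *)
Lemma gaudin_eigenvalue_real w g (e : C) : (forall i, w i \is Num.real) ->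
  g != 0 -> gaudin w g = e *: g -> e \is Num.real.
Proof.
move=> wr g0 eig.
have N_gt0 : 0 < \sum_J `|g J| ^+ 2.
  rewrite lt0r sumr_ge0 ?andbT => [|J _]; last exact: exprn_ge0.
  by apply: contra_neq g0; exact: norm_eq0.
suff eN : e * (\sum_J `|g J| ^+ 2) \is Num.real.
  rewrite -[e](mulfK (lt0r_neq0 N_gt0)).
  by apply: rpredM => //; rewrite rpredV gtr0_real.
have -> : e * (\sum_J `|g J| ^+ 2) = \sum_J gaudin w g J * conjv g J.
  rewrite eig mulr_sumr; apply: eq_bigr => J _.
  by rewrite vectZ conjvE normCK mulrA.
have wJ J : \sum_(i in J) w i \is Num.real by apply: rpred_sum.
have -> : \sum_J gaudin w g J * conjv g J =
    \sum_J `|lowering w g J| ^+ 2 + \sum_(J : {set I}) (- (\sum_(i in J) w i ^+ 2)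
    - (\sum_i w i) * (\sum_(i in J) w i) + (\sum_(i in J) w i) ^+ 2) * `|g J| ^+ 2.
  have -> : \sum_J `|lowering w g J| ^+ 2 = \sum_J raising w (lowering w g) J * conjv g J.
    rewrite raising_adjoint; apply: eq_bigr => J _.
    by rewrite lowering_conj // normCK.
  rewrite -big_split; apply: eq_bigr => J _ /=.
  rewrite /gaudin !vectE !weightE conjvE normCK; ring.
rewrite rpredD // rpred_sum // => J _; first by rewrite realX ?normr_real.
rewrite rpredM ?realX ?normr_real // rpredD ?rpredB ?rpredN ?rpredM ?realX ?rpred_sum //.
by move=> i _; rewrite realX.
Qed.

(** This is the commutation relation [lowering_raising] read on norms: the
    operator h acts by n - 2 #|J| on the basis vector of J. *)
Lemma norm_raising1 g : \sum_J `|raising (fun=> 1) g J| ^+ 2 =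
  \sum_J `|lowering (fun=> 1) g J| ^+ 2
  + \sum_(J : {set I}) (#|I|%:R - 2 * #|J|%:R) * `|g J| ^+ 2.
Proof.
have r1 (i : I) : (1 : C) \is Num.real by exact: real1.
have -> : \sum_J `|raising (fun=> 1) g J| ^+ 2 =
    \sum_J g J * lowering (fun=> 1) (raising (fun=> 1) (conjv g)) J.
  rewrite -raising_adjoint raising_conj //; apply: eq_bigr => J _.
  by rewrite normCK conjvE.
have -> : \sum_J `|lowering (fun=> 1) g J| ^+ 2 =
    \sum_J g J * raising (fun=> 1) (lowering (fun=> 1) (conjv g)) J.
  under [RHS]eq_bigr do rewrite mulrC.
  rewrite raising_adjoint; apply: eq_bigr => J _.
  by rewrite lowering_conj // normCK mulrC.
rewrite -big_split; apply: eq_bigr => J _ /=.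
rewrite lowering_raising !vectE weightE conjvE normCK.
rewrite mulr1 !sumr_const; ring.
Qed.

(** Raising is injective below the middle level. If all the coefficients are 1,
    then this follows from [norm_raising1], whose last sum is positive at level
    k < n / 2. In general, divide each coordinate by the product of the a_i. *)
Lemma raising_inj k a g : (forall i, a i != 0) -> (k.*2 < #|I|)%N ->
  (forall J, #|J| != k -> g J = 0) -> raising a g = 0 -> g = 0.
Proof.
move=> a0 k_lt supp Fg0.
pose h : vect := [ffun J : {set I} => g J / \prod_(i in J) a i].
have p0 J : \prod_(i in J) a i != 0 by apply/prodf_neq0 => i _.
have Fh0 : raising (fun=> 1) h = 0.
  apply/ffunP => J; rewrite raisingE [RHS]ffunE.
  transitivity (raising a g J / \prod_(i in J) a i); last by rewrite Fg0 ffunE mul0r.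
  rewrite raisingE mulr_suml; apply: eq_bigr => i iJ.
  rewrite ffunE (finset.big_setD1 i iJ) /=; field.
  by rewrite a0 p0.
suff h0 : h = 0.
  apply/ffunP => J; move/ffunP/(_ J): h0; rewrite !ffunE => /eqP.
  by rewrite mulf_eq0 invr_eq0 (negPf (p0 J)) orbF => /eqP.
apply: norm_eq0; apply/eqP; rewrite -(mulrI_eq0 _ (x := #|I|%:R - 2 * k%:R)); last first.
  apply/lregP; rewrite subr_eq0 -natrM eqr_nat; apply: contraTneq k_lt => ->.
  by rewrite -mul2n ltnn.
have kI : 0 <= #|I|%:R - 2 * k%:R :> C.
  by rewrite subr_ge0 -natrM ler_nat mul2n ltnW.
have /eqP := norm_raising1 h; rewrite Fh0.
under eq_bigr do rewrite ffunE normr0 expr0n.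
rewrite big1 // eq_sym paddr_eq0; first last.
- apply: sumr_ge0 => J _; have [->|/supp gJ] := eqVneq #|J| k.
    by rewrite mulr_ge0 ?exprn_ge0.
  by rewrite ffunE gJ mul0r normr0 expr0n mulr0.
- by apply: sumr_ge0 => J _; rewrite exprn_ge0.
case/andP => _ /eqP sum0; apply/eqP; rewrite -[RHS]sum0 mulr_sumr; apply: eq_bigr => J _.
have [->//|/supp gJ] := eqVneq #|J| k.
by rewrite ffunE gJ mul0r normr0 expr0n !mulr0.
Qed.

Variable z : I -> C.

Lemma bethe_supp s J : #|J| != size s -> bethe z s J = 0.
Proof.
elim: s J => [|t s IH] J /=; first by rewrite ffunE cards_eq0 => /negPf->.
move=> Js; rewrite raisingE big1 // => i iJ; rewrite IH ?mulr0 //.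
by apply: contra Js; rewrite (cardsD1 i J) iJ.
Qed.

(** Every raising operator used to build the Bethe vector starts from a level
    strictly below the middle. *)
Lemma bethe_neq0 s : (forall r, r \in s -> forall i, r != z i) ->
  ((size s).*2 <= #|I|.+1)%N -> bethe z s != 0.
Proof.
elim: s => [|t s IH] sz /= s_le.
  apply/eqP => /ffunP/(_ finset.set0); rewrite !ffunE eqxx => /eqP; by rewrite oner_eq0.
have {}IH : bethe z s != 0.
  apply: IH => [r rs|]; first by apply: sz; rewrite inE rs orbT.
  by apply: leq_trans s_le; rewrite leq_double.
apply: contra_neq IH; apply: (@raising_inj (size s)) => [i||J]; last exact: bethe_supp.
  by rewrite invr_eq0 subr_eq0 sz // inE eqxx.
by rewrite doubleS ltnS in s_le.
Qed.

(** The Bethe equations enter as the vanishing of the off-shell terms. *)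
Lemma energy_real s x : (forall i, z i \is Num.real) -> x \is Num.real ->
    uniq s -> x \notin s -> (forall i, x != z i) ->
    (forall r, r \in s -> forall i, r != z i) ->
    (forall r, r \in s -> \sum_i pole z r i = 2 * logder (rem r s) r) ->
    ((size s).*2 <= #|I|.+1)%N ->
  energy z s x \is Num.real.
Proof.
move=> zr xr us xs xz sz bethe_eq s_le.
apply: (@gaudin_eigenvalue_real (pole z x) (bethe z s)).
- by move=> i; rewrite rpredV rpredB.
- exact: bethe_neq0.
rewrite gaudin_bethe_offshell // big1_seq ?addr0 // => r /= rs.
by rewrite bethe_eq // subrr mul0r scale0r.
Qed.

End Positivity.

(** * Wronskians of polynomials *)

Section Wronskian.
Variable C : numClosedFieldType.
Implicit Types (p q P Q V W : {poly C}) (s zs ts : seq C).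

Definition wronskian p q : {poly C} := p^`() * q - p * q^`().

Definition conjp p := map_poly Num.conj_op p.

Lemma poly_nat_nonroot p : p != 0 -> exists n, p.[n%:R] != 0.
Proof.
move=> p0; have : ~~ all (root p) [seq n%:R | n <- iota 0 (size p)].
  apply/negP => roots; have := max_poly_roots p0 roots.
  rewrite size_map size_iota ltnn => /(_ _)/notF; apply.
  rewrite map_inj_uniq ?iota_uniq //; exact: (mulrIn (oner_neq0 C)).
by case/allPn => _ /mapP[n _ ->] pn; exists n.
Qed.

Lemma conjp_horner p x : x \is Num.real -> (conjp p).[x] = (p.[x])^*.
Proof. by move=> xr; rewrite -{1}(CrealP xr) horner_map. Qed.

(** A polynomial and its conjugate that agree at infinitely many real points
    are equal. *)
Lemma real_values_conjp p s :
  (forall x, x \is Num.real -> x \notin s -> p.[x] \is Num.real) -> conjp p = p.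
Proof.
move=> pr; apply/eqP; rewrite -subr_eq0; apply/negPn/negP => d0.
have [|n] := @poly_nat_nonroot ((conjp p - p) * rootpoly s).
  by rewrite mulf_neq0 // monic_neq0 // monic_prod_XsubC.
rewrite hornerM mulf_eq0 negb_or => /andP[dn]; rewrite -[_ == 0]/(root _ _).
rewrite root_prod_XsubC => /(pr _ (realn _ _))/CrealP pnr.
by rewrite hornerD hornerN conjp_horner ?realn // pnr subrr eqxx in dn.
Qed.

Lemma coef_top_mul p q a b : (size p <= a.+1)%N -> (size q <= b.+1)%N ->
  (p * q)`_(a + b) = p`_a * q`_b.
Proof.
move=> pa qb; rewrite coefM.
have alt : (a < (a + b).+1)%N by rewrite ltnS leq_addr.
rewrite (bigD1 (Ordinal alt)) //= addKn big1 ?addr0 // => i ia.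
have [ai|ia'|ai] := ltngtP a i.
- by rewrite nth_default ?mul0r // (leq_trans pa).
- rewrite [q`_ _]nth_default ?mulr0 // (leq_trans qb) //.
  by rewrite ltn_subRL ltn_add2r.
- by case/eqP: ia; apply/val_inj.
Qed.

Lemma coefXderiv p i : ('X * p^`())`_i = i%:R * p`_i.
Proof. by rewrite coefXM coef_deriv; case: i => [|i] /=; rewrite ?mul0r // mulr_natl. Qed.

Lemma size_Xderiv p a : (size p <= a.+1)%N -> (size ('X * p^`())%R <= a.+1)%N.
Proof.
move=> pa; apply/leq_sizeP => j aj.
by rewrite coefXderiv nth_default ?mulr0 // (leq_trans pa).
Qed.

(** Multiplying by X makes the top coefficient uniform: X d/dx multiplies the
    coefficient of degree k by k, even for k = 0. *)
Lemma coef_wronskian p q a b : (size p <= a.+1)%N -> (size q <= b.+1)%N ->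
  ('X * wronskian p q)`_(a + b) = (a%:R - b%:R) * p`_a * q`_b.
Proof.
move=> pa qb; rewrite /wronskian mulrBr mulrA [p * _]mulrC mulrA coefB.
rewrite (coef_top_mul (size_Xderiv pa) qb) addnC (coef_top_mul (size_Xderiv qb) pa).
by rewrite !coefXderiv; ring.
Qed.

(** The top coefficient does not cancel when the degrees differ. *)
Lemma size_wronskian p q : q != 0 -> (size q < size p)%N ->
  (size p + size q <= (size (wronskian p q)).+2)%N.
Proof.
move=> q0 qp; have p0 : p != 0 by rewrite -size_poly_gt0 (leq_ltn_trans _ qp).
have qs : (0 < size q)%N by rewrite size_poly_gt0.
have ps : (0 < size p)%N by rewrite size_poly_gt0.
have := @coef_wronskian p q (size p).-1 (size q).-1.
rewrite !prednK // => /(_ (leqnn _) (leqnn _)).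
case: leqP => // small; rewrite nth_default; last first.
  rewrite (leq_trans (size_polyMleq _ _)) // size_polyX /=.
  move: (size (wronskian p q)) (size p) (size q) small ps qs; lia.
move=> /esym/eqP; rewrite !mulf_eq0 -!lead_coefE !lead_coef_eq0 (negPf p0) (negPf q0) !orbF.
rewrite subr_eq0 eqr_nat -eqSS !prednK // => /eqP pq; by rewrite pq ltnn in qp.
Qed.

(** By [coef_wronskian], p and q have the same degree unless p = 0. Subtracting
    from p the multiple of q that lowers its degree leaves the wronskian zero,
    so it leaves 0. *)
Lemma wronskian0 p q : q != 0 -> wronskian p q = 0 -> exists c, p = c *: q.
Proof.
move=> q0; have size_eq (f : {poly C}) : wronskian f q = 0 -> f != 0 -> size f = size q.
  move=> w0 f0; have fs : (0 < size f)%N by rewrite size_poly_gt0.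
  have qs : (0 < size q)%N by rewrite size_poly_gt0.
  have := @coef_wronskian f q (size f).-1 (size q).-1.
  rewrite !prednK // => /(_ (leqnn _) (leqnn _)).
  rewrite w0 mulr0 coef0 => /esym/eqP.
  rewrite !mulf_eq0 -!lead_coefE !lead_coef_eq0 (negPf f0) (negPf q0) !orbF.
  by rewrite subr_eq0 eqr_nat -eqSS !prednK // => /eqP.
move=> w0; have [->|p0] := eqVneq p 0; first by exists 0; rewrite scale0r.
have spq := size_eq _ w0 p0; exists (lead_coef p / lead_coef q).
apply/eqP; rewrite -subr_eq0; apply/negPn/negP => d0.
have wd : wronskian (p - (lead_coef p / lead_coef q) *: q) q = 0.
  by rewrite -[RHS]w0 /wronskian derivB derivZ -!mul_polyC; ring.
have sd := size_eq _ wd d0.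
have lq0 : lead_coef q != 0 by rewrite lead_coef_eq0.
have : (p - (lead_coef p / lead_coef q) *: q)`_(size q).-1 = 0.
  by rewrite coefB coefZ -{1}spq -!lead_coefE divfK // subrr.
by rewrite -sd -lead_coefE => /eqP; rewrite lead_coef_eq0 (negPf d0).
Qed.

End Wronskian.

(** * Pencils with a real-rooted wronskian *)

Section RealPencil.
Variable C : numClosedFieldType.
Implicit Types (p q P Q V W : {poly C}) (s zs ts : seq C).

Lemma conjpK p : conjp (conjp p) = p.
Proof.
by apply/polyP => i; rewrite !coef_map; exact: conjCK.
Qed.

Lemma conjpD p q : conjp (p + q) = conjp p + conjp q. Proof. exact: rmorphD. Qed.
Lemma conjpB p q : conjp (p - q) = conjp p - conjp q. Proof. exact: rmorphB. Qed.
Lemma conjpZ (c : C) p : conjp (c *: p) = c^* *: conjp p. Proof. exact: map_polyZ. Qed.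

Lemma conjp_wronskian p q : conjp (wronskian p q) = wronskian (conjp p) (conjp q).
Proof. by rewrite /wronskian /conjp rmorphB !rmorphM /= !deriv_map. Qed.

Lemma conjp_rootpoly s : {in s, forall r, r \is Num.real} ->
  conjp (rootpoly s) = rootpoly s.
Proof.
move=> sr; rewrite /conjp /rootpoly rmorph_prod; apply: eq_big_seq => r rs /=.
by rewrite rmorphB /= map_polyX map_polyC /= (CrealP (sr r rs)).
Qed.

Lemma size_conjp p : size (conjp p) = size p.
Proof. exact: size_map_poly. Qed.

Lemma rootpoly_rem r s : r \in s -> rootpoly s = ('X - r%:P) * rootpoly (rem r s).
Proof. by move=> rs; rewrite /rootpoly (big_rem r rs). Qed.

(** Together with its analogue for p, this says that the pencil of p and q
    consists of solutions of W u'' - W' u' + V u = 0, with V = p'' q' - p' q''. *)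
Lemma wronskian_ode p q :
  wronskian p q * q^`()^`() - (wronskian p q)^`() * q^`()
    + wronskian p^`() q^`() * q = 0.
Proof. by rewrite /wronskian derivB !derivM; ring. Qed.

(** The heart of the proof: the potential V of the differential equation is real
    because - V / W is an eigenvalue of a real symmetric operator, and a real
    equation has a real solution of smallest degree. *)
Lemma real_pencil_monic P Q zs : {in zs, forall r, r \is Num.real} ->
    Q \is monic -> (size Q < size P)%N -> wronskian P Q = rootpoly zs ->
    (forall x, root Q x -> x \notin zs) ->
  conjp Q = Q /\ exists c, conjp (P + c *: Q) = P + c *: Q.
Proof.
move=> zsr Qmonic sQP wr Qzs.
have Q0 : Q != 0 by rewrite monic_neq0.
have [ts Qts] : exists ts, Q = rootpoly ts.
  have [ts Qts] := closed_field_poly_normal Q; exists ts.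
  by rewrite Qts (monicP Qmonic) scale1r.
have rootQ x : root Q x = (x \in ts) by rewrite Qts /rootpoly root_prod_XsubC.
have Wneq0 x : x \notin zs -> (wronskian P Q).[x] != 0.
  by rewrite wr; exact: rootpoly_neq0.
(* At a double root of Q, the wronskian would vanish. *)
have uts : uniq ts.
  rewrite -separable_prod_XsubC -/(rootpoly ts) -Qts separable_poly.unlock.
  apply: Pdiv.ClosedField.root_coprimep => x Qx.
  apply: contra_neq (Wneq0 x (Qzs x Qx)) => dQx.
  by rewrite /wronskian hornerD hornerN !hornerM (rootP Qx) dQx !mulr0 subrr.
have zsts r : r \in ts -> r \notin zs by rewrite -rootQ; exact: Qzs.
pose I := 'I_(size zs); pose z (i : I) := zs`_i.
have zP x : x \notin zs -> forall i, x != z i.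
  by move=> xz i; apply: contraNneq xz => ->; apply: mem_nth.
have sum_pole x : \sum_i pole z x i = logder zs x.
  by rewrite /logder (big_nth 0) big_mkord.
have logder_W x : x \notin zs ->
    logder zs x = (wronskian P Q)^`().[x] / (wronskian P Q).[x].
  by move=> xz; rewrite wr deriv_rootpoly // mulrAC mulfV ?mul1r // rootpoly_neq0.
pose V := wronskian P^`() Q^`().
have ode x : (wronskian P Q).[x] * Q^`()^`().[x] - (wronskian P Q)^`().[x] * Q^`().[x]
     + V.[x] * Q.[x] = 0.
  by have := congr1 (horner^~ x) (wronskian_ode P Q); rewrite !hornerE.
(* The logarithmic derivative of Q / (X - r) at r is Q'' / (2 Q'), and Q'' / Q'
   is W' / W by the differential equation. *)
have bethe_eq r : r \in ts -> \sum_i pole z r i = 2 * logder (rem r ts) r.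
  move=> rts; have Wr := Wneq0 r (zsts r rts).
  rewrite sum_pole logder_W ?zsts //.
  have rr : r \notin rem r ts by rewrite mem_rem_uniqF.
  have Q'r : Q^`().[r] = (rootpoly (rem r ts)).[r].
    rewrite Qts (rootpoly_rem rts) derivM derivXsubC mul1r.
    by rewrite hornerD hornerM hornerXsubC subrr mul0r addr0.
  have Q''r : Q^`()^`().[r] = 2 * (Q^`().[r] * logder (rem r ts) r).
    rewrite {1}Qts (rootpoly_rem rts) derivM derivXsubC mul1r.
    rewrite derivD derivM derivXsubC mul1r.
    rewrite !hornerD hornerM hornerXsubC subrr mul0r addr0 deriv_rootpoly // -Q'r; ring.
  have Q'0 : Q^`().[r] != 0 by rewrite Q'r rootpoly_neq0.
  have Qr0 : Q.[r] = 0 by apply/rootP; rewrite rootQ.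
  have := ode r; rewrite Qr0 mulr0 addr0 Q''r => H.
  apply: (mulIf Q'0); apply: (mulIf Wr).
  move/eqP: H; rewrite subr_eq0 => /eqP H; rewrite mulrAC divfK // -H; ring.
have size_zs : size zs = (size (wronskian P Q)).-1.
  by rewrite wr size_prod_XsubC.
have size_ts : size ts = (size Q).-1 by rewrite Qts size_prod_XsubC.
have sW := size_wronskian Q0 sQP.
have sQ : (0 < size Q)%N by rewrite size_poly_gt0.
have Vr : conjp V = V.
  apply: (@real_values_conjp _ _ (ts ++ zs)) => x xr.
  rewrite mem_cat negb_or => /andP[xts xzs].
  have er : energy z ts x \is Num.real.
    apply: energy_real => //.
    - by move=> i; apply: zsr; apply: mem_nth.
    - exact: zP.
    - by move=> r /zsts; exact: zP.
    - by rewrite card_ord size_zs size_ts; lia.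
  have Wr : (wronskian P Q).[x] \is Num.real.
    apply/CrealP; rewrite -conjp_horner // wr conjp_rootpoly //.
  have Qx : Q.[x] != 0 by rewrite Qts rootpoly_neq0.
  suff -> : V.[x] = - (energy z ts x * (wronskian P Q).[x]) by rewrite rpredN rpredM.
  rewrite /energy sum_pole logder_W // -Qts.
  have W0 := Wneq0 x xzs; apply: (mulIf Qx).
  have /eqP := ode x; rewrite addrC addr_eq0 => /eqP ->.
  by field; rewrite W0 Qx.
have Wc : conjp (wronskian P Q) = wronskian P Q by rewrite wr conjp_rootpoly.
have odec : wronskian P Q * (conjp Q)^`()^`() - (wronskian P Q)^`() * (conjp Q)^`()
     + V * conjp Q = 0.
  have := congr1 (@conjp C) (wronskian_ode P Q).
  rewrite -/V conjpD conjpB /conjp !rmorphM rmorph0 /= -!deriv_map -!/(conjp _).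
  by rewrite Vr Wc.
have W0 : wronskian P Q != 0 by rewrite wr monic_neq0 // monic_prod_XsubC.
(* By Abel's identity, the wronskian w of two solutions satisfies w' W = w W'. *)
have w0 : wronskian (conjp Q) Q = 0.
  have : wronskian (wronskian (conjp Q) Q) (wronskian P Q) = 0.
    have o1 := wronskian_ode P Q; rewrite -/V in o1.
    transitivity (Q * (wronskian P Q * (conjp Q)^`()^`()
      - (wronskian P Q)^`() * (conjp Q)^`() + V * conjp Q)
      - conjp Q * (wronskian P Q * Q^`()^`() - (wronskian P Q)^`() * Q^`() + V * Q));
      last by rewrite o1 odec !mulr0 subrr.
    rewrite {1}/wronskian [(wronskian (conjp Q) Q)^`()]derivB !derivM.
    rewrite [wronskian (conjp Q) Q]/wronskian; ring.
  case/(wronskian0 W0) => c wc.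
  case: (eqVneq c 0) => [c0|c0]; first by rewrite wc c0 scale0r.
  have : (size (wronskian (conjp Q) Q) <= (size Q + size Q).-2)%N.
    have sQ' := lt_size_deriv Q0.
    have sQc' : (size (conjp Q)^`() < size Q)%N.
      by rewrite deriv_map -/(conjp _) size_conjp.
    rewrite (leq_trans (size_polyD _ _)) // size_polyN geq_max.
    have aux (k l m : nat) : (0 < m)%N -> (k < m)%N -> (l <= m)%N ->
      ((k + l).-1 <= (m + m).-2)%N by lia.
    apply/andP; split; apply: (leq_trans (size_polyMleq _ _)); last rewrite addnC.
      exact: aux.
    by apply: aux; rewrite ?size_conjp.
  have big (k l w : nat) : (k + l <= w.+2)%N -> (l < k)%N -> (0 < l)%N ->
    (w <= (l + l).-2)%N -> False by lia.
  by rewrite wc size_scale // => /(big _ _ _ sW sQP sQ).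
have Qr : conjp Q = Q.
  have [c Qc] := wronskian0 Q0 w0; rewrite Qc.
  have : lead_coef (conjp Q) = 1.
    by rewrite lead_coef_map_inj ?(monicP Qmonic) ?rmorph1 ?rmorph0 //; exact: fmorph_inj.
  by rewrite Qc lead_coefZ (monicP Qmonic) mulr1 => ->; rewrite scale1r.
split=> //.
have : wronskian (conjp P - P) Q = 0.
  rewrite /wronskian derivB !(mulrBl, mulrBr).
  have := Wc; rewrite conjp_wronskian Qr /wronskian => /eqP.
  by rewrite -subr_eq0 => /eqP <-; ring.
case/(wronskian0 Q0) => c; move=> /eqP; rewrite subr_eq => /eqP PcE.
(* Conjugating twice shows that c is imaginary, so that adding c / 2 Q makes P
   real. *)
have cc : c^* = - c.
  have := conjpK P; rewrite PcE conjpD conjpZ Qr PcE addrA -[RHS]add0r => /addIr.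
  rewrite -scalerDl => /eqP; rewrite scaler_eq0 (negPf Q0) orbF addr_eq0 => /eqP -> //.
exists (c / 2); rewrite conjpD conjpZ Qr PcE rmorphM fmorphV rmorph_nat /= cc.
by rewrite addrAC -scalerDl addrC; congr (_ + _ *: _); field.
Qed.

End RealPencil.

(** * Moving a real point to infinity *)

Section Inversion.
Variable C : numClosedFieldType.
Implicit Types (p q P Q u : {poly C}) (d : nat) (x : C).

Lemma wronskianZ (a b : C) p q : wronskian (a *: p) (b *: q) = (a * b) *: wronskian p q.
Proof. by rewrite /wronskian !derivZ -!mul_polyC polyCM; ring. Qed.

Lemma wronskian_comb (a b : C) p q : wronskian p (a *: q - b *: p) = a *: wronskian p q.
Proof. by rewrite /wronskian derivB !derivZ -!mul_polyC; ring. Qed.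

(** The sign is that of the combinations that vanish at a given point. *)
Lemma wronskian_free (a b : C) p q :
  wronskian p q != 0 -> a *: q - b *: p = 0 -> (a == 0) && (b == 0).
Proof.
move=> w0 e; have a0 : a = 0.
  have := wronskian_comb a b p q; rewrite e /wronskian deriv0 !mulr0 subrr.
  by move/esym/eqP; rewrite scaler_eq0 (negPf w0) orbF => /eqP.
rewrite a0 eqxx; move: e; rewrite a0 scale0r sub0r => /eqP.
rewrite oppr_eq0 scaler_eq0 => /orP[->//|/eqP p0].
by rewrite p0 /wronskian deriv0 !mul0r subrr eqxx in w0.
Qed.

(** Normalizes the basis so that [real_pencil_monic] applies. *)
Lemma real_pencil_lt P Q : (forall x, root (wronskian P Q) x -> x \is Num.real) ->
    Q != 0 -> (size Q < size P)%N ->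
    (forall x, root Q x -> ~~ root (wronskian P Q) x) ->
  exists a b c : C, [/\ a * c != 0, conjp (a *: P + b *: Q) = a *: P + b *: Q
    & conjp (c *: Q) = c *: Q].
Proof.
move=> wr Q0 sQP QW.
have P0 : P != 0 by rewrite -size_poly_gt0 (leq_ltn_trans _ sQP).
have W0 : wronskian P Q != 0.
  rewrite -size_poly_gt0; have := size_wronskian Q0 sQP.
  have sQ : (0 < size Q)%N by rewrite size_poly_gt0.
  have big (k l w : nat) :
    (0 < l)%N -> (l < k)%N -> (k + l <= w.+2)%N -> (0 < w)%N by lia.
  exact: big.
have [zs Wzs] := closed_field_poly_normal (wronskian P Q).
have W0' : lead_coef (wronskian P Q) != 0 by rewrite lead_coef_eq0.
have Q0' : lead_coef Q != 0 by rewrite lead_coef_eq0.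
have rootW x : root (wronskian P Q) x = (x \in zs).
  by rewrite Wzs rootZ // root_prod_XsubC.
pose a := lead_coef Q / lead_coef (wronskian P Q).
pose c := (lead_coef Q)^-1.
have a0 : a != 0 by rewrite mulf_neq0 ?invr_eq0.
have c0 : c != 0 by rewrite invr_eq0.
have [||||x|Qr [b Pr]] := @real_pencil_monic _ (a *: P) (c *: Q) zs.
- by move=> r; rewrite -rootW; exact: wr.
- by rewrite monicE lead_coefZ mulVf.
- by rewrite !size_scale.
- rewrite wronskianZ Wzs scalerA -[RHS]scale1r; congr (_ *: _).
  by rewrite /a /c; field; rewrite Q0' W0'.
- by rewrite rootZ // -rootW; exact: QW.
exists a, (b * c), c; split => //; first by rewrite mulf_neq0.
by rewrite -[(b * c) *: Q]scalerA.
Qed.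

(** The polynomial x^d p(1/x), for p of degree at most d. *)
Definition revp d p : {poly C} := \poly_(i < d.+1) p`_(d - i).

Lemma coef_revp d p i : (revp d p)`_i = if (i <= d)%N then p`_(d - i) else 0.
Proof. by rewrite coef_poly ltnS. Qed.

Lemma size_revp d p : (size (revp d p) <= d.+1)%N. Proof. exact: size_poly. Qed.

Lemma revp_is_linear d : linear (revp d).
Proof.
move=> a p q; apply/polyP => i; rewrite coefD coefZ !coef_revp coefD coefZ.
by case: ifP => _ //; rewrite mulr0 addr0.
Qed.
HB.instance Definition _ d :=
  GRing.isLinear.Build C {poly C} {poly C} _ (revp d) (revp_is_linear d).

Lemma revpK d p : (size p <= d.+1)%N -> revp d (revp d p) = p.
Proof.
move=> pd; apply/polyP => i; rewrite !coef_revp leq_subr.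
by case: leqP => [/subKn->//|di]; rewrite nth_default // (leq_trans pd).
Qed.

Lemma conjp_revp d p : conjp (revp d p) = revp d (conjp p).
Proof.
apply/polyP => i; rewrite coef_map /= !coef_revp coef_map /=.
by case: ifP => _ //; rewrite rmorph0.
Qed.

Lemma horner_revp d p x : (size p <= d.+1)%N -> x != 0 ->
  (revp d p).[x] = x ^+ d * p.[x^-1].
Proof.
move=> pd x0; rewrite (horner_coef_wide _ (size_revp d p)) (horner_coef_wide _ pd).
rewrite mulr_sumr (reindex_inj rev_ord_inj) /=; apply: eq_bigr => i _.
have id : (i <= d)%N by rewrite -ltnS.
rewrite coef_revp subSS leq_subr subKn // mulrCA; congr (_ * _).
by rewrite exprVn -expfB_cond ?(negPf x0) ?add0n.
Qed.

(** Euler's relation: reversal sends the degree k to d - k, so it exchanges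
    X d/dx and d - X d/dx. *)
Lemma Xderiv_revp d p : 'X * (revp d p)^`() = d%:R *: revp d p - revp d ('X * p^`()).
Proof.
apply/polyP => i; rewrite coefXderiv coefB coefZ !coef_revp coefXderiv.
case: leqP => [id|_]; last by rewrite !mulr0 subr0.
by rewrite natrB //; ring.
Qed.

(** Wronskians transform as forms under x |-> 1/x: the terms with the factor d
    in [Xderiv_revp] cancel. *)
Lemma root_wronskian_revp d p q x : (size p <= d.+1)%N -> (size q <= d.+1)%N -> x != 0 ->
  root (wronskian (revp d p) (revp d q)) x -> root (wronskian p q) x^-1.
Proof.
move=> pd qd x0 /rootP wx.
have : ('X * wronskian (revp d p) (revp d q)).[x]
     = - (x ^+ (2 * d)) * x^-1 * (wronskian p q).[x^-1].
  rewrite /wronskian mulrBr mulrA [revp d p * _]mulrC mulrA !Xderiv_revp.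
  rewrite !(hornerM, hornerD, hornerN, hornerZ) !horner_revp ?size_Xderiv //.
  rewrite !hornerM !hornerX mulnC exprM; ring.
rewrite hornerM wx mulr0 => /esym/eqP; rewrite !mulf_eq0 oppr_eq0 invr_eq0 expf_eq0.
by rewrite (negPf x0) andbF /= /root.
Qed.

Definition shiftp (x0 : C) p := p \Po ('X + x0%:P).

Lemma size_shiftp x0 p : size (shiftp x0 p) = size p.
Proof. by rewrite size_comp_poly2 // size_XaddC. Qed.

Lemma horner_shiftp x0 p x : (shiftp x0 p).[x] = p.[x + x0].
Proof. by rewrite horner_comp hornerD hornerX hornerC. Qed.

Lemma wronskian_shiftp x0 p q :
  wronskian (shiftp x0 p) (shiftp x0 q) = shiftp x0 (wronskian p q).
Proof.
rewrite /wronskian /shiftp !deriv_comp derivD derivX derivC addr0 !mulr1.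
by rewrite comp_polyB !comp_polyM.
Qed.

Lemma shiftpK x0 p : shiftp (- x0) (shiftp x0 p) = p.
Proof.
by rewrite /shiftp -comp_polyA comp_polyD comp_polyX comp_polyC polyCN subrK comp_polyXr.
Qed.

Lemma conjp_shiftp x0 p : x0 \is Num.real -> conjp (shiftp x0 p) = shiftp x0 (conjp p).
Proof.
move=> xr; rewrite /conjp /shiftp map_comp_poly.
by rewrite rmorphD /= map_polyX map_polyC /= (CrealP xr).
Qed.

Lemma coef_shiftp x0 p d : (size p <= d.+1)%N -> (shiftp x0 p)`_d = p`_d.
Proof.
rewrite leq_eqVlt ltnS => /orP[/eqP pd|pd]; last first.
  by rewrite !nth_default ?size_shiftp.
have := lead_coef_comp p (q := 'X + x0%:P); rewrite size_XaddC lead_coefXaddC expr1n mulr1.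
by move=> /(_ isT); rewrite !lead_coefE -/(shiftp x0 p) size_shiftp pd.
Qed.

(** In terms of homogeneous forms: p and q have no common zero at infinity. *)
Lemma coef_maxn_size p q : q != 0 ->
  ~~ ((p`_(maxn (size p) (size q)).-1 == 0) && (q`_(maxn (size p) (size q)).-1 == 0)).
Proof.
move=> q0; rewrite negb_and; case: (ltnP (size q) (size p)) => qp.
  have p0 : p != 0 by rewrite -size_poly_gt0 (leq_ltn_trans _ qp).
  by rewrite -lead_coefE lead_coef_eq0 p0.
by rewrite orbC -lead_coefE lead_coef_eq0 q0.
Qed.

Lemma real_roots_neq0 p : (forall x, root p x -> x \is Num.real) -> p != 0.
Proof.
move=> pr; apply/eqP => p0; have /pr : root p 'i by rewrite p0 root0.
by rewrite (negPf (nonRealCi C)).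
Qed.

(** The change of variable x = x0 + 1/y carries the pencil to one in which the
    combination g of p and q that vanishes at x0 has the smaller degree. For x0
    outside the zeros of finitely many nonzero polynomials, g does not vanish at
    any critical point, infinity included: this is the coprimality with the
    wronskian that [real_pencil_lt] requires. *)
Theorem real_pencil p q : coprimep p q ->
    (forall x, root (wronskian p q) x -> x \is Num.real) ->
  exists a b c d : C, [/\ a * d - b * c != 0,
    conjp (a *: p + b *: q) = a *: p + b *: q &
    conjp (c *: p + d *: q) = c *: p + d *: q].
Proof.
move=> pq Wr.
have W0 := real_roots_neq0 Wr.
have p0 : p != 0.
  by apply: contraNneq W0 => ->; rewrite /wronskian deriv0 !mul0r subrr.
pose d := (maxn (size p) (size q)).-1.
have sp0 : (0 < size p)%N by rewrite size_poly_gt0.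
have pd : (size p <= d.+1)%N by rewrite /d; lia.
have qd : (size q <= d.+1)%N by rewrite /d; lia.
have [zs Wzs] := closed_field_poly_normal (wronskian p q).
have rootW x : root (wronskian p q) x = (x \in zs).
  by rewrite Wzs rootZ ?lead_coef_eq0 // root_prod_XsubC.
have comb0 (a b : C) : ~~ ((a == 0) && (b == 0)) -> a *: q - b *: p != 0.
  by apply: contra => /eqP; exact: wronskian_free.
have q0 : q != 0.
  by apply: contraNneq W0 => ->; rewrite /wronskian deriv0 !mulr0 subrr.
have pqd : p`_d *: q - q`_d *: p != 0.
  apply: comb0; exact: coef_maxn_size.
have pqr r : p.[r] *: q - q.[r] *: p != 0.
  apply: comb0; apply/negP => /andP[pr /eqP qr].
  by have := coprimep_root pq pr; rewrite qr eqxx.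
(* At x0, the three factors say that p does not vanish at x0, so that the pencil
   keeps degree d after the change of variable, and that p / q takes at x0 a
   value different from those at infinity and at the critical points. *)
pose B := p * (p`_d *: q - q`_d *: p) * \prod_(r <- zs) (p.[r] *: q - q.[r] *: p).
have B0 : B != 0.
  by rewrite !mulf_neq0 // prodf_seq_neq0; apply/allP => r _; rewrite pqr.
have [n Bn] := poly_nat_nonroot B0.
set x0 : C := n%:R in Bn; have x0r : x0 \is Num.real by exact: realn.
move: Bn; rewrite /B !hornerM !mulf_eq0 !negb_or => /andP[/andP[px0 pqx0] prod0].
pose g := p.[x0] *: q - q.[x0] *: p.
have gr r : r \in zs -> ~~ root g r.
  move=> rzs; move: prod0; rewrite horner_prod prodf_seq_neq0 => /allP/(_ r rzs) /=.
  have -> : (p.[r] *: q - q.[r] *: p).[x0] = - g.[r].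
    by rewrite /g !(hornerD, hornerN, hornerZ); ring.
  by rewrite oppr_eq0.
have g0 : g != 0 by apply: comb0; rewrite (negPf px0).
have gd : (size g <= d.+1)%N.
  rewrite (leq_trans (size_polyD _ _)) // size_polyN geq_max.
  by rewrite !(leq_trans (size_scale_leq _ _)).
pose T u := revp d (shiftp x0 u).
have TK u : (size u <= d.+1)%N -> shiftp (- x0) (revp d (T u)) = u.
  by move=> ud; rewrite revpK ?size_shiftp // shiftpK.
have TB u v : T (u - v) = T u - T v by rewrite /T /shiftp comp_polyB linearB.
have TD u v : T (u + v) = T u + T v by rewrite /T /shiftp comp_polyD linearD.
have TZ k u : T (k *: u) = k *: T u by rewrite /T /shiftp comp_polyZ linearZ.
(* The values at y = 0 and y = infinity correspond to those at x = infinity and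
   x = x0. *)
have T0 u : (size u <= d.+1)%N -> (T u)`_0 = u`_d.
  by move=> ud; rewrite coef_revp subn0 coef_shiftp.
have Td u : (T u)`_d = u.[x0].
  by rewrite coef_revp leqnn subnn -horner_coef0 horner_shiftp add0r.
have Treal u : (size u <= d.+1)%N -> conjp (T u) = T u -> conjp u = u.
  move=> ud; rewrite /T conjp_revp conjp_shiftp // -!/(T _) => Tu.
  by rewrite -[RHS](TK u ud) -Tu TK // size_conjp.
have Wroot x : x != 0 -> root (wronskian (T p) (T q)) x -> root (wronskian p q) (x^-1 + x0).
  move=> xn0 /root_wronskian_revp; rewrite !size_shiftp => /(_ pd qd xn0).
  by rewrite wronskian_shiftp /root horner_shiftp.
have WT : wronskian (T p) (T g) = p.[x0] *: wronskian (T p) (T q).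
  by rewrite TB !TZ wronskian_comb.
have gx0 : g.[x0] = 0 by rewrite !(hornerD, hornerN, hornerZ) mulrC subrr.
have [||||a [b [c [ac0 abr cr]]]] := @real_pencil_lt (T p) (T g).
- move=> x; rewrite WT rootZ // => Wx.
  have [->|xn0] := eqVneq x 0; first exact: real0.
  have /Wr xr := Wroot x xn0 Wx.
  by rewrite -[x]invrK rpredV -[x^-1](addrK x0) rpredB.
- by apply: contraNneq g0 => Tg; rewrite -(TK g gd) Tg linear0 /shiftp comp_poly0.
- have -> : size (T p) = d.+1.
    apply/eqP; rewrite eqn_leq size_revp ltnNge; apply/negP => /leq_sizeP/(_ _ (leqnn _)).
    by move/eqP; rewrite Td (negPf px0).
  rewrite ltnS; apply/leq_sizeP => j; rewrite leq_eqVlt => /orP[/eqP<-|dj].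
    by rewrite Td.
  by rewrite nth_default // (leq_trans (size_revp _ _)).
- move=> x; rewrite WT rootZ //; have [->|xn0] := eqVneq x 0.
    rewrite /root horner_coef0 T0 //.
    have -> // : g`_d = - (p`_d *: q - q`_d *: p).[x0].
      by rewrite /g coefB !coefZ !(hornerD, hornerN, hornerZ); ring.
    by rewrite oppr_eq0 (negPf pqx0).
  rewrite {1}/root horner_revp ?size_shiftp // mulf_eq0 expf_eq0 (negPf xn0) andbF.
  rewrite horner_shiftp => gx; apply: contraL gx => Wx.
  by apply: gr; rewrite -rootW; exact: Wroot.
exists (a - b * q.[x0]), (b * p.[x0]), (- (c * q.[x0])), (c * p.[x0]).
have E1 : a *: p + b *: g = (a - b * q.[x0]) *: p + (b * p.[x0]) *: q.
  by rewrite /g -!mul_polyC !(polyCM, polyCB); ring.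
have E2 : c *: g = - (c * q.[x0]) *: p + (c * p.[x0]) *: q.
  by rewrite /g -!mul_polyC !(polyCM, polyCN); ring.
have szc (k : C) u : (size u <= d.+1)%N -> (size (k *: u)%R <= d.+1)%N.
  by move=> ud; rewrite (leq_trans (size_scale_leq _ _)).
split; rewrite -?E1 -?E2.
- have -> : (a - b * q.[x0]) * (c * p.[x0]) - b * p.[x0] * - (c * q.[x0]) = a * c * p.[x0].
    by ring.
  by rewrite mulf_neq0.
- apply: Treal; last by rewrite TD !TZ.
  by rewrite (leq_trans (size_polyD _ _)) // geq_max !szc.
- by apply: Treal; [exact: szc | rewrite TZ].
Qed.

End Inversion.

(** * Rational functions and their critical points *)

Lemma is_derive_horner (K : numFieldType) (p : {poly K}) (x : K) :
  is_derive (x : K^o) 1 (horner p : K^o -> K^o) p^`().[x].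
Proof.
elim/poly_ind: p => [|p c IH].
  have -> : horner (0 : {poly K}) = cst 0 by apply/funext => y; rewrite horner0.
  by rewrite deriv0 horner0; exact: is_derive_cst.
have -> : horner (p * 'X + c%:P) = (horner p : K^o -> K^o) * id + cst c.
  by apply/funext => y; rewrite !hornerE.
apply: is_derive_eq.
rewrite derivD derivM derivX derivC addr0 mulr1 !hornerE.
by rewrite /GRing.scale /= mulr1 addrC mulrC.
Qed.

Section RationalMaps.
Variable R : realType.
Local Notation C := R[i].
Implicit Types (p q : {poly C}) (z : C).

Lemma is_derive_quotient p q z : q.[z] != 0 -> root (wronskian p q) z ->
  is_derive (z : C^o) 1 ((fun w => p.[w] / q.[w]) : C^o -> C^o) 0.
Proof.
move=> qz /rootP wz.
have [dp p'] := is_derive_horner p z; have [dq q'] := is_derive_horner q z.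
have dV := derivableV qz dq.
split; first exact: (derivableM dp dV).
rewrite (deriveM dp dV) (deriveV qz dq) p' q' /GRing.scale /=.
have -> : p^`().[z] = p.[z] * q^`().[z] / q.[z].
  apply: (mulIf qz); rewrite divfK //; apply/eqP; rewrite -subr_eq0 -[X in _ == X]wz.
  by rewrite /wronskian hornerD hornerN !hornerM.
by field.
Qed.

(** In the charts, the map is p / q away from its poles and q / p at a pole. Since
    infinity has affine coordinate 0 and the inverse of 0 is 0, these identities
    hold everywhere, not only near z. *)
Lemma critical_wronskian p q z : coprimep p q -> root (wronskian p q) z ->
  critical_point (rational_map p q) (Some z).
Proof.
move=> pq wz; rewrite /critical_point /=.
case: (eqVneq q.[z] 0) => qz /=.
  (* A pole: in the chart 1 / w at the target, the map is q / p. *)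
  have pz : p.[z] != 0.
    by apply/negP => /(coprimep_root pq); rewrite qz eqxx.
  have -> : (@affine_coord R \o @CP1_inv R) \o rational_map p q \o Some
    = ((fun w => q.[w] / p.[w]) : C^o -> C^o).
    apply/funext => w /=; case: (eqVneq q.[w] 0) => [->|qw] /=; first by rewrite mul0r.
    case: (eqVneq p.[w] 0) => [->|pw] /=; first by rewrite mul0r eqxx invr0 mulr0.
    by rewrite mulf_eq0 invr_eq0 (negPf pw) (negPf qw) /= invf_div.
  apply: is_derive_quotient => //.
  have -> : wronskian q p = - wronskian p q by rewrite /wronskian; ring.
  by rewrite rootN.
have -> : @affine_coord R \o rational_map p q \o Some
    = ((fun w => p.[w] / q.[w]) : C^o -> C^o).
  by apply/funext => w /=; case: (eqVneq q.[w] 0) => [->|qw] //=; rewrite invr0 mulr0.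
exact: is_derive_quotient.
Qed.

Lemma conjp_real p : conjp p = p -> exists p0 : {poly R}, p = map_poly (real_complex R) p0.
Proof.
move=> pr; exists (map_poly (@complex.Re R) p); apply/polyP => i.
rewrite !coef_map_id0 // RRe_real //; apply/CrealP.
by rewrite -{2}pr coef_map.
Qed.

(** This form treats p and q alike, as homogeneous forms of the common degree d,
    and thus behaves well under a change of basis of the pencil. *)
Lemma rational_map_infty p q d : q != 0 -> (maxn (size p) (size q)).-1 = d ->
  rational_map p q None = if q`_d == 0 then None else Some (p`_d / q`_d).
Proof.
move=> q0 <-; rewrite /=; have qs : (0 < size q)%N by rewrite size_poly_gt0.
case: ltnP => [qp|pq].
  by rewrite nth_default ?eqxx // -ltnS prednK // (leq_ltn_trans _ qp).
by rewrite -lead_coefE lead_coef_eq0 (negPf q0).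
Qed.

(** A change of basis of the pencil is a fractional-linear change of the
    value. *)
Lemma rational_function_pencil (f : CP1 R -> CP1 R) p q a b c d :
    a * d - b * c != 0 -> q != 0 -> coprimep p q -> f =1 rational_map p q ->
    conjp (a *: p + b *: q) = a *: p + b *: q ->
    conjp (c *: p + d *: q) = c *: p + d *: q -> c *: p + d *: q != 0 ->
  exists l : CP1 R -> CP1 R, fractional_linear l /\ real_rational_function (l \o f).
Proof.
move=> det q0 pq fE /conjp_real[p0 p0E] /conjp_real[q0' q0E] cd0.
pose l (x : CP1 R) : CP1 R := match x with
  | Some z => if c * z + d == 0 then None else Some ((a * z + b) / (c * z + d))
  | None => if c == 0 then None else Some (a / c)
  end.
exists l; split; first by exists a, b, c, d.
pose P := a *: p + b *: q; pose Q := c *: p + d *: q.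
have inv_p : p = (a * d - b * c)^-1 *: (d *: P - b *: Q).
  apply: (scalerI det); rewrite scalerA mulfV // scale1r /P /Q -!mul_polyC.
  by rewrite !(polyCM, polyCB); ring.
have inv_q : q = (a * d - b * c)^-1 *: (a *: Q - c *: P).
  apply: (scalerI det); rewrite scalerA mulfV // scale1r /P /Q -!mul_polyC.
  by rewrite !(polyCM, polyCB); ring.
have size_comb (s t : C) (u v : {poly C}) :
    (size (s *: u + t *: v)%R <= maxn (size u) (size v))%N.
  rewrite (leq_trans (size_polyD _ _)) // geq_max !(leq_trans (size_scale_leq _ _)) //.
    exact: leq_maxr.
  exact: leq_maxl.
have sizes : maxn (size P) (size Q) = maxn (size p) (size q).
  have p_le : (size p <= maxn (size P) (size Q))%N.
    by rewrite {1}inv_p (leq_trans (size_scale_leq _ _)) // -scaleNr size_comb.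
  have q_le : (size q <= maxn (size P) (size Q))%N.
    by rewrite {1}inv_q (leq_trans (size_scale_leq _ _)) // -scaleNr maxnC size_comb.
  by apply/eqP; rewrite eqn_leq !geq_max !size_comb p_le q_le.
have cop : coprimep P Q.
  apply: Pdiv.ClosedField.root_coprimep => x /rootP Px; apply/eqP => Qx.
  have px : root p x.
    by rewrite /root inv_p hornerZ hornerD hornerN !hornerZ Px Qx !mulr0 subrr mulr0.
  have := coprimep_root pq px.
  by rewrite inv_q hornerZ hornerD hornerN !hornerZ Px Qx !mulr0 subrr mulr0 eqxx.
(* The action of l in homogeneous coordinates. *)
have lE (u v : C) : (u == 0) && (v == 0) = false ->
    l (if v == 0 then None else Some (u / v))
    = if c * u + d * v == 0 then None else Some ((a * u + b * v) / (c * u + d * v)).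
  case: (eqVneq v 0) => [->|v0].
    rewrite andbT => u0; rewrite !mulr0 !addr0 mulf_eq0 u0 orbF /=.
    by case: eqVneq => // c0; rewrite -mulf_div divff ?u0 // mulr1.
  move=> _ /=; have -> : c * (u / v) + d = (c * u + d * v) / v by field.
  rewrite mulf_eq0 invr_eq0 (negPf v0) orbF; case: eqVneq => // cd0'.
  by congr Some; field; rewrite v0 cd0'.
exists p0, q0'; split.
- by rewrite -(map_poly_eq0 (real_complex R)) -q0E.
- by rewrite -(coprimep_map (real_complex R)) -p0E -q0E.
move=> x; rewrite /= fE -p0E -q0E; case: x => [z|].
  rewrite /= lE ?hornerD ?hornerZ //.
  by apply/negP => /andP[pz]; apply/negP; exact: coprimep_root pq pz.
rewrite (rational_map_infty q0 erefl) (rational_map_infty cd0 (congr1 predn sizes)).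
rewrite lE ?coefD ?coefZ //.
by apply/negbTE; apply: coef_maxn_size.
Qed.

End RationalMaps.

Theorem theorem1 (R : realType) (f : CP1 R -> CP1 R)
  (f_rational : rational_function f)
  (f_crit_real : forall x : CP1 R, critical_point f x -> real_point x) :
  exists l : CP1 R -> CP1 R,
    fractional_linear l /\ real_rational_function (l \o f).
Proof.
have [p [q [q0 pq fE]]] := f_rational.
have Wr z : root (wronskian p q) z -> z \is Num.real.
  move=> /(critical_wronskian pq); rewrite -(funext fE) => /f_crit_real /=.
  by case: z => x y /= y0; rewrite complex_real y0.
have [a [b [c [d [det pr qr]]]]] := real_pencil pq Wr.
apply: (rational_function_pencil det q0 pq fE pr qr).
apply: contra_neq det => cd0.
have := @wronskian_free _ d (- c) p q (real_roots_neq0 Wr).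
rewrite scaleNr opprK addrC oppr_eq0 => /(_ cd0)/andP[/eqP-> /eqP->].
by rewrite !mulr0 subrr.
Qed.
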